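(* Let $X$ and $U$ be Banach spaces, let $A$ generate a $C_0$-semigroup $(T(t))_{t\ge 0}$ on $X$, let $B\in\mathcal L(U,X_{-1})$, and let $\Sigma(A,B)$ be the associated linear control system. Suppose there is a Young function $\Phi$ such that the system $\Sigma(A,B)$ is $E_\Phi$-sISS. Then the system $\Sigma(A,B)$ is $L^\infty$-siISS.
   Context: **System.** $X_{-1}$ is the completion of $X$ with respect to $\|x\|_{-1}:=\|(\lambda I-A)^{-1}x\|$, for some $\lambda\in\rho(A)$. The semigroup $(T(t))_{t\ge0}$ extends to a $C_0$-semigroup $(T_{-1}(t))_{t\ge0}$ on $X_{-1}$. $\Sigma(A,B)$ denotes the system $\dot x(t)=Ax(t)+Bu(t)$, $t\ge 0$, $x(0)=x_0$. Its mild solution, for $x_0\in X$ and input $u$, is the (a priori $X_{-1}$-valued) function $x(t)=T(t)x_0+\int_0^t T_{-1}(t-s)Bu(s)\,ds$, $t\ge 0$. **Young functions and Orlicz spaces.** A Young function is a function $\Phi:[0,\infty)\to\mathbb R$ of the form $\Phi(t)=\int_0^t\varphi(s)\,ds$, where $\varphi:[0,\infty)\to\mathbb R$ is right-continuous and nondecreasing, $\varphi(0)=0$, $\varphi(s)>0$ for $s>0$, and $\lim_{s\to\infty}\varphi(s)=\infty$. For an interval $I\subset\mathbb R$, $L_\Phi(I;U)$ is the space of (a.e.-classes of) Bochner-measurable $u:I\to U$ for which there is $k>0$ with $\int_I\Phi(k^{-1}\|u(x)\|_U)\,dx<\infty$, with the Luxemburg norm $\|u\|_{L_\Phi(I;U)}=\inf\{k>0: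 \int_I\Phi(k^{-1}\|u(x)\|_U)\,dx\le 1\}$. For bounded $I$, $E_\Phi(I;U)$ is the closure of $L^\infty(I;U)$ in $L_\Phi(I;U)$, with the norm of $L_\Phi(I;U)$. Write $Z(0,t;U)$ for $L^p(0,t;U)$ ($1\le p\le\infty$) when $Z=L^p$ and for $E_\Phi(0,t;U)$ when $Z=E_\Phi$. **Comparison functions.** $\mathcal K$: continuous strictly increasing $\mu:[0,\infty)\to[0,\infty)$ with $\mu(0)=0$. $\mathcal K_\infty$: those $\theta\in\mathcal K$ with $\lim_{x\to\infty}\theta(x)=\infty$. $\mathcal L$: continuous strictly decreasing $\gamma:[0,\infty)\to[0,\infty)$ with $\lim_{t\to\infty}\gamma(t)=0$. **Strong ISS.** $\Sigma(A,B)$ is $Z$-sISS (strongly input-to-state stable with respect to $Z$) if there exist $\mu\in\mathcal K$ and $\beta:X\times[0,\infty)\to[0,\infty)$ such that $\beta(x,\cdot)\in\mathcal L$ for all $x\in X$, $x\neq 0$, and for every $t\ge0$, $x_0\in X$, $u\in Z(0,t;U)$ the state $x(t)$ lies in $X$ and $\|x(t)\|\le\beta(x_0,t)+\mu(\|u\|_{Z(0,t;U)})$. **Strong integral ISS.** $\Sigma(A,B)$ is $Z$-siISS (strongly integral input-to-state stable with respect to $Z$) if there exist $\theta\in\mathcal K_\infty$, $\mu\in\mathcal K$ and $\beta:X\times[0,\infty)\to[0,\infty)$ such that $\beta(x,\cdot)\in\mathcal L$ for all $x\in X$, $x\ne0$, and for every $t\ge0$, $x_0\in X$, $u\in Z(0,t;U)$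 the state $x(t)$ lies in $X$ and $\|x(t)\|\le\beta(x_0,t)+\theta\left(\int_0^t\mu(\|u(s)\|_U)\,ds\right)$. *)

(* Defs.v *)
From HB Require Import structures.
From mathcomp Require Import all_boot all_order all_algebra.
From mathcomp Require Import all_classical all_reals all_analysis.
Set Implicit Arguments.
Unset Strict Implicit.
Unset Printing Implicit Defensive.
Import Order.TTheory GRing.Theory Num.Theory.
Import numFieldNormedType.Exports.
Local Open Scope classical_set_scope.
Local Open Scope ring_scope.

(* Banach spaces are over the reals R.  A complex Banach space is one of them
   by restriction of scalars; the notions below do not change under it (the
   point lambda of the resolvent set of a generator can be taken real).
   A function on [0, +oo[ is a function on R whose values at negative
   arguments are irrelevant, and an element of a space of (classes of)
   functions on D : set R is a function on R considered up to equality almost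
   everywhere on D. *)

(** Bochner measurability and the Bochner integral over D, with respect to the
    Lebesgue measure.  The measurable sets are the Borel sets; since limits are
    taken almost everywhere, this is the same as working with the
    Lebesgue-measurable sets. *)

Definition simple_on (R : realType) (V : completeNormedModType R)
    (D : set R) (s : R -> V) : Prop :=
  finite_set (s @` D) /\
  forall v : V, measurable (D `&` s @^-1` [set v] : set (measurableTypeR R)) /\
    (v != 0 -> (lebesgue_measure (D `&` s @^-1` [set v]) < +oo)%E).

Definition simple_integral (R : realType) (V : completeNormedModType R)
    (D : set R) (s : R -> V) : V :=
  \sum_(v \in s @` D) fine (lebesgue_measure (D `&` s @^-1` [set v])) *: v.

Definition bochner_measurable (R : realType) (V : completeNormedModType R)
    (D : set R) (f : R -> V) : Prop :=
  exists s : nat -> R -> V,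
    (forall n, simple_on D (s n)) /\
    {ae lebesgue_measure, forall x : R, D x -> s n x @[n --> \oo] --> f x}.

Definition is_bochner_integral (R : realType) (V : completeNormedModType R)
    (D : set R) (f : R -> V) (y : V) : Prop :=
  bochner_measurable D f /\
  exists s : nat -> R -> V,
    [/\ forall n, simple_on D (s n),
        (\int[lebesgue_measure]_(x in D) `|f x - s n x|%:E)%E
          @[n --> \oo] --> 0%E
      & simple_integral D (s n) @[n --> \oo] --> y].

(** Semigroups *)

Definition c0_semigroup (R : realType) (X : completeNormedModType R)
    (T : R -> {linear X -> X}) : Prop :=
  [/\ forall t : R, 0 <= t -> continuous (T t),
      forall x, T 0 x = x,
      forall s t : R, 0 <= s -> 0 <= t -> forall x, T (s + t) x = T s (T t x)
    & forall x, T h x @[h --> 0^'+] --> x].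

(* An unbounded operator is a map A : X -> X together with its domain; the
   values of A outside the domain are irrelevant. *)
Definition generator (R : realType) (X : completeNormedModType R)
    (T : R -> {linear X -> X}) (domA : set X) (A : X -> X) : Prop :=
  (forall x, domA x <-> exists y : X, h^-1 *: (T h x - x) @[h --> 0^'+] --> y) /\
  (forall x, domA x -> h^-1 *: (T h x - x) @[h --> 0^'+] --> A x).

(* lambda belongs to the resolvent set of A and Rl = (lambda I - A)^-1. *)
Definition is_resolvent (R : realType) (X : completeNormedModType R)
    (domA : set X) (A : X -> X) (lambda : R) (Rl : {linear X -> X}) : Prop :=
  [/\ continuous Rl,
      forall x, domA (Rl x) /\ lambda *: Rl x - A (Rl x) = x
    & forall x, domA x -> Rl (lambda *: x - A x) = x].

(* Y, with the embedding i, is the completion of X for the norm |Rl x|. *)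
Definition is_extrapolation_space (R : realType) (X Y : completeNormedModType R)
    (Rl : {linear X -> X}) (i : {linear X -> Y}) : Prop :=
  (forall x, `|i x| = `|Rl x|) /\ dense (range i).

Definition extends_semigroup (R : realType) (X Y : completeNormedModType R)
    (i : {linear X -> Y}) (T : R -> {linear X -> X})
    (Tm : R -> {linear Y -> Y}) : Prop :=
  c0_semigroup Tm /\ forall t : R, 0 <= t -> forall x, Tm t (i x) = i (T t x).

(* The mild solution at time t, a priori an element of Y, is i x; that is, it
   lies in X and is equal to x. *)
Definition is_state (R : realType) (X U Y : completeNormedModType R)
    (i : {linear X -> Y}) (T : R -> {linear X -> X})
    (Tm : R -> {linear Y -> Y}) (B : {linear U -> Y})
    (t : R) (x0 : X) (u : R -> U) (x : X) : Prop :=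
  exists2 y : Y,
    is_bochner_integral `[0, t] (fun s => Tm (t - s) (B (u s))) y
    & i x = i (T t x0) + y.

(** Young functions and Orlicz spaces *)

Definition young (R : realType) (Phi : R -> R) : Prop :=
  exists phi : R -> R,
    (forall s : R, 0 <= s -> phi x @[x --> s^'+] --> phi s) /\
    (forall s t : R, 0 <= s -> s <= t -> phi s <= phi t) /\
    phi 0 = 0 /\
    (forall s : R, 0 < s -> 0 < phi s) /\
    phi x @[x --> +oo] --> +oo /\
    (forall t : R, 0 <= t ->
      Phi t = (\int[lebesgue_measure]_(s in `[0%R, t]) phi s)%R).

Definition orlicz_modular (R : realType) (U : completeNormedModType R)
    (Phi : R -> R) (D : set R) (u : R -> U) (k : R) : \bar R :=
  (\int[lebesgue_measure]_(x in D) (Phi (k^-1 * `|u x|)%R)%:E)%E.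

Definition LPhi (R : realType) (U : completeNormedModType R)
    (Phi : R -> R) (D : set R) : set (R -> U) :=
  [set u | bochner_measurable D u /\
    exists2 k : R, 0 < k & (orlicz_modular Phi D u k < +oo)%E].

Definition luxemburg_norm (R : realType) (U : completeNormedModType R)
    (Phi : R -> R) (D : set R) (u : R -> U) : R :=
  inf [set k : R | 0 < k /\ (orlicz_modular Phi D u k <= 1)%E].

Definition Linfty (R : realType) (U : completeNormedModType R)
    (D : set R) : set (R -> U) :=
  [set u | bochner_measurable D u /\
    exists M : R, {ae lebesgue_measure, forall x : R, D x -> `|u x| <= M}].

(* For bounded D. *)
Definition EPhi (R : realType) (U : completeNormedModType R)
    (Phi : R -> R) (D : set R) : set (R -> U) :=
  [set u | LPhi Phi D u /\ forall e : R, 0 < e ->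
    exists2 v, Linfty D v & luxemburg_norm Phi D (u \- v) < e].

(** Comparison functions *)

Definition classK (R : realType) (mu : R -> R) : Prop :=
  [/\ {within `[0, +oo[, continuous mu},
      forall x y : R, 0 <= x -> x < y -> mu x < mu y
    & mu 0 = 0].

Definition classKinfty (R : realType) (theta : R -> R) : Prop :=
  classK theta /\ theta x @[x --> +oo] --> +oo.

Definition classL (R : realType) (gamma : R -> R) : Prop :=
  [/\ {within `[0, +oo[, continuous gamma},
      forall t : R, 0 <= t -> 0 <= gamma t,
      forall s t : R, 0 <= s -> s < t -> gamma t < gamma s
    & gamma t @[t --> +oo] --> 0].

(** Stability.  Z D is the space of inputs on D, and normZ D its norm. *)

Definition sISS (R : realType) (X U Y : completeNormedModType R)
    (i : {linear X -> Y}) (T : R -> {linear X -> X})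
    (Tm : R -> {linear Y -> Y}) (B : {linear U -> Y})
    (Z : set R -> set (R -> U)) (normZ : set R -> (R -> U) -> R) : Prop :=
  exists mu : R -> R, exists beta : X -> R -> R,
    [/\ classK mu,
        forall (x : X) (t : R), 0 <= t -> 0 <= beta x t,
        forall x : X, x != 0 -> classL (beta x)
      & forall (t : R) (x0 : X) (u : R -> U), 0 <= t -> Z `[0, t]%classic u ->
          exists2 x, is_state i T Tm B t x0 u x
            & `|x| <= beta x0 t + mu (normZ `[0, t]%classic u)].

Definition siISS (R : realType) (X U Y : completeNormedModType R)
    (i : {linear X -> Y}) (T : R -> {linear X -> X})
    (Tm : R -> {linear Y -> Y}) (B : {linear U -> Y})
    (Z : set R -> set (R -> U)) : Prop :=
  exists theta : R -> R, exists mu : R -> R, exists beta : X -> R -> R,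
    [/\ classKinfty theta, classK mu,
        forall (x : X) (t : R), 0 <= t -> 0 <= beta x t,
        forall x : X, x != 0 -> classL (beta x)
      & forall (t : R) (x0 : X) (u : R -> U), 0 <= t -> Z `[0, t]%classic u ->
          exists2 x, is_state i T Tm B t x0 u x
            & `|x| <= beta x0 t +
                theta (\int[lebesgue_measure]_(s in `[0%R, t]) mu `|u s|)%R].

(* Main.v *)
Require Import Defs.
From mathcomp Require Import all_boot all_order all_algebra.
From mathcomp Require Import all_classical all_reals all_analysis.
From mathcomp Require Import measurable_realfun ring lra.
Set Implicit Arguments.
Unset Strict Implicit.
Unset Printing Implicit Defensive.
Import Order.TTheory GRing.Theory Num.Theory.
Import numFieldNormedType.Exports.
Local Open Scope classical_set_scope.
Local Open Scope ring_scope.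

(** Write F_t u for the response at time t to the input u from the initial
    state 0.  By linearity it is x(t) - T(t) x0 for every initial state x0, so
    the strong ISS estimate, used at one fixed nonzero x0 for the input u and
    for the input 0, gives a constant C with |F_t u| <= C, uniformly in t,
    whenever the Luxemburg norm of u is at most 1
    ([forced_response_bound]).  An essentially bounded u is then rescaled: with
    J = int Phi(|u| / k), convexity shows that u / (k (1 + J)) lies in the unit
    ball ([luxemburg_norm_amemiya]), whence

      |F_t u| <= C (k + k int Phi(|u| / k))   for every k > 0.

    It remains to bound the right-hand side by a function of one integral that
    does not involve k.  The gauge mu(s) = s + Phi(s^2) grows so much faster
    than Phi that k Phi(s / k) <= (1 + Phi(1 / k^2)) mu(s) for all s >= 0 and
    0 < k <= 1 ([young_dominated]): if s >= 1 / k then s / k <= s^2, and if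
    s <= 1 / k then s / k = (s k) / k^2 with s k <= 1, so convexity applies.
    Putting a = int mu(|u|), |F_t u| is at most the infimum over k of the affine
    functions k + D(k) a, where D(k) depends on Phi and C only.  This infimum
    is finite, nondecreasing and continuous in a, also at a = 0 where it
    vanishes because k may be small; adding a turns it into a function theta of
    class K_infinity ([classKinfty_envelope]).  The function beta of the
    hypothesis serves again, since the strong ISS estimate for the input 0
    reads |T(t) x0| <= beta(x0, t).

    The linearity of u |-> F_t u is the homogeneity, including the uniqueness,
    of the Bochner integral ([bochner_integral_scale]).  Since a Bochner
    measurable function is only almost everywhere a limit of Borel simple
    functions, its norm need not be Borel measurable; the integral of a
    nonnegative function, being a supremum over the simple functions below it,
    is still monotone and homogeneous ([ae_le_integral_scale]), and that is
    enough. *)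

(** * Integrals of nonnegative functions that may fail to be measurable *)

Section LowerIntegral.
Import HBNNSimple.

(** The integral is the supremum over the simple functions below the integrand,
    so only those have to be measurable: one that is below [f], set to zero on
    the exceptional null set and divided by [c], is below [g]. *)
Lemma ae_le_integral_scale d (T : measurableType d) (R : realType)
    (mu : {measure set T -> \bar R}) (D : set T) (f g : T -> R) (c : R) :
  0 < c -> (forall x, D x -> 0 <= f x) -> (forall x, D x -> 0 <= g x) ->
  {ae mu, forall x, D x -> f x <= c * g x} ->
  (\int[mu]_(x in D) (f x)%:E <= c%:E * \int[mu]_(x in D) (g x)%:E)%E.
Proof.
move=> c0 f0 g0 [N [mN muN sN]].
have ci0 : 0 <= c^-1 by rewrite invr_ge0 ltW.
rewrite ge0_integralE; last by move=> x Dx; rewrite lee_fin f0.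
apply: ge_ereal_sup => _ [h hf <-].
pose h' := scale_nnsfun (proj_nnsfun h (measurableC mN)) ci0.
have h'E x : h' x = c^-1 * (h x * \1_(~` N) x) by [].
have mEh (k : {nnsfun T >-> R}) : measurable_fun setT (EFin \o (k : T -> R)).
  exact/measurable_EFinP.
have -> : sintegral mu h = (c%:E * sintegral mu h')%E.
  have sE (k : {nnsfun T >-> R}) : sintegral mu k = (\int[mu]_x (k x : R)%:E)%E.
    by rewrite integral_nnsfun// patch_setT.
  rewrite !sE -ge0_integralZl//; last 3 first.
  - exact: mEh.
  - by move=> x _; rewrite lee_fin.
  - by rewrite lee_fin ltW.
  apply: ge0_ae_eq_integral => //.
  - exact: mEh.
  - by apply: measurable_funeM; exact: mEh.
  - by move=> x _; rewrite lee_fin.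
  - by move=> x _; rewrite mule_ge0 ?lee_fin ?(ltW c0).
  - exists N; split => // x /=; apply: contra_notP => Nx _.
    have hE : h x = c * h' x.
      by rewrite h'E mulVKf ?gt_eqF// indicE mem_set// mulr1.
    by rewrite -EFinM; congr EFin.
rewrite lee_pmul2l//.
rewrite ge0_integralE; last by move=> x Dx; rewrite lee_fin g0.
apply: ereal_sup_ubound; exists h' => // x; have := hf x.
rewrite h'E !patchE; case: ifPn => [|_].
  rewrite inE => Dx; rewrite !lee_fin => hfx.
  rewrite indicE; case: (boolP (x \in ~` N)) => [|_]; last first.
    by rewrite mulr0 mulr0 g0.
  rewrite inE => Nx; rewrite mulr1 ler_pdivrMl//; apply: (le_trans hfx).
  by apply: contrapT => /= fcg; apply: Nx; apply: sN => /= /(_ Dx).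
rewrite !lee_fin => hx.
have -> : h x = 0 by apply/eqP; rewrite eq_le hx fun_ge0.
by rewrite mul0r mulr0.
Qed.

Lemma ae_le_integral_ge0 d (T : measurableType d) (R : realType)
    (nu : {measure set T -> \bar R}) (D : set T) (f g : T -> R) :
  (forall x, D x -> 0 <= f x) -> (forall x, D x -> 0 <= g x) ->
  {ae nu, forall x, D x -> f x <= g x} ->
  (\int[nu]_(x in D) (f x)%:E <= \int[nu]_(x in D) (g x)%:E)%E.
Proof.
move=> f0 g0 fg; rewrite -[leRHS]mul1e; apply: ae_le_integral_scale => //.
by apply: filterS fg => x h Dx; rewrite mul1r; exact: h.
Qed.

End LowerIntegral.

Lemma lebesgue_bounded_itv_lty (R : realType) (x y : bool) (a b : R) :
  (lebesgue_measure ([set` Interval (BSide x a) (BSide y b)] : set R) < +oo)%E.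
Proof.
have -> := @lebesgue_measure_itv R (Interval (BSide x a) (BSide y b)).
by case: ifP => // _; rewrite ltry.
Qed.

(** * Young functions *)

(** All that is used about a Young function follows from this sandwich: the
    increment over [a, b] lies between the values at a and b of the density,
    times b - a. *)
Lemma young_increment (R : realType) (Phi : R -> R) : young Phi ->
  exists phi : R -> R,
    [/\ phi 0 = 0,
        forall s t : R, 0 <= s -> s <= t -> phi s <= phi t
      & forall a b, 0 <= a -> a <= b ->
          (b - a) * phi a <= Phi b - Phi a <= (b - a) * phi b].
Proof.
move=> [phi [_ [nd [phi0 [_ [_ PhiE]]]]]].
exists phi; split=> // a b a0 ab.
have b0 := le_trans a0 ab.
(* phi is monotone on [0, +oo[ only; the cut-off makes it so everywhere. *)
have mphi (D : set R) : measurable D ->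
    D `<=` `[0, b]%classic -> measurable_fun D phi.
  move=> mD Db.
  have mm : measurable_fun D (fun x => phi (Num.max 0 x)).
    apply: nondecreasing_measurable => // x y xy.
    apply: nd; first by rewrite le_max lexx.
    by rewrite ge_max !le_max lexx xy orbT.
  apply: eq_measurable_fun mm => x.
  by rewrite inE => /Db; rewrite /= in_itv /= => /andP[x0 _]; rewrite max_r.
have iphi (i : interval R) : [set` i] `<=` `[0, b]%classic ->
    lebesgue_measure.-integrable [set` i] (EFin \o phi).
  move=> ib; apply: (@integrableS _ _ _ lebesgue_measure `[0, b]%classic) => //.
  apply: measurable_bounded_integrable => //.
  - exact: lebesgue_bounded_itv_lty.
  - exact: mphi.
  exists (`|phi 0| + `|phi b|); split; first by rewrite num_real.
  move=> M hM x /=; rewrite in_itv/= => /andP[x0 xb].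
  apply: le_trans (ltW hM); rewrite ler_norml.
  have := nd _ _ (lexx 0) x0; have := nd _ _ x0 xb.
  have := ler_norm (phi b); have := ler_norm (- phi 0); rewrite normrN.
  have := normr_ge0 (phi b); have := normr_ge0 (phi 0).
  by move=> *; apply/andP; split; lra.
rewrite !PhiE// Rintegral_itvB//; last exact: iphi.
have iab : [set` `]a, b]] `<=` `[0, b].
  by move=> x /=; rewrite !in_itv/= => /andP[/ltW/(le_trans a0)-> ->].
have cstE (c : R) :
    (\int[lebesgue_measure]_(s in `]a, b]) c)%R = (b - a) * c.
  rewrite Rintegral_cst// mulrC; congr (_ * _).
  apply: (eq_trans (congr1 fine (@lebesgue_measure_itv R `]a, b]))).
  rewrite /= lte_fin.
  by case: ltgtP ab => // -> _; rewrite subrr.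
have icst (c : R) : lebesgue_measure.-integrable [set` `]a, b]] (EFin \o cst c).
  apply: measurable_bounded_integrable => //.
    exact: lebesgue_bounded_itv_lty.
  by exists `|c|; split; [rewrite num_real|move=> M /ltW cM x _].
rewrite -!cstE; apply/andP; split; apply: le_Rintegral => //; try exact: iphi;
  try exact: icst.
- by move=> x /=; rewrite in_itv/= => /andP[/ltW ax _]; exact: nd.
- move=> x /=; rewrite in_itv/= => /andP[/ltW ax xb].
  by apply: nd => //; exact: le_trans ax.
Qed.

Lemma young0 (R : realType) (Phi : R -> R) : young Phi -> Phi 0 = 0.
Proof.
by move=> [phi [_ [_ [_ [_ [_ ->]]]]]] //; rewrite set_itv1 Rintegral_set1.
Qed.

Lemma le_young (R : realType) (Phi : R -> R) : young Phi ->
  forall a b, 0 <= a -> a <= b -> Phi a <= Phi b.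
Proof.
move=> /young_increment[phi [phi0 nd inc]] a b a0 ab.
have /andP[+ _] := inc a b a0 ab.
rewrite -(subr_ge0 (Phi a)); apply: le_trans.
by rewrite mulr_ge0 ?subr_ge0// -phi0 nd.
Qed.

Lemma young_ge0 (R : realType) (Phi : R -> R) : young Phi ->
  forall x, 0 <= x -> 0 <= Phi x.
Proof. by move=> hPhi x x0; rewrite -(young0 hPhi) le_young. Qed.

(** Convexity on segments that start at 0: the sandwich compares both
    Phi (l s) - Phi 0 and Phi s - Phi (l s) with the density at l s. *)
Lemma young_scale_le (R : realType) (Phi : R -> R) : young Phi ->
  forall l s, 0 <= l <= 1 -> 0 <= s -> Phi (l * s) <= l * Phi s.
Proof.
move=> hPhi l s /andP[l0 l1] s0.
have [phi [phi0 nd inc]] := young_increment hPhi.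
have ls0 : 0 <= l * s by rewrite mulr_ge0.
have lss : l * s <= s by rewrite ler_piMl.
have /andP[_] := inc 0 (l * s) (lexx 0) ls0.
have /andP[+ _] := inc (l * s) s ls0 lss.
rewrite (young0 hPhi) !subr0 => h1 h2.
have h1l := ler_wpM2l l0 h1.
have l1' : 0 <= 1 - l by rewrite subr_ge0.
have h2l := ler_wpM2l l1' h2.
by nra.
Qed.

(** Squaring makes the values of Phi at negative arguments, which are
    arbitrary, disappear. *)
Lemma continuous_young_sqr (R : realType) (Phi : R -> R) : young Phi ->
  continuous (fun s : R => Phi (s ^+ 2)).
Proof.
move=> hPhi s.
have [phi [phi0 nd inc]] := young_increment hPhi.
have phi_ge0 r : 0 <= r -> 0 <= phi r by move=> r0; rewrite -phi0 nd.
(* The sandwich makes Phi Lipschitz on bounded sets, with constant L near the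
   square of s. *)
apply/cvgrPdist_le => e e0.
pose L := phi ((`|s| + 1) ^+ 2) + 1.
have L0 : 0 < L by rewrite ltr_wpDl// phi_ge0// exprn_ge0// addr_ge0.
have lip a b : 0 <= a -> a <= b -> b <= (`|s| + 1) ^+ 2 ->
    `|Phi b - Phi a| <= (b - a) * L.
  move=> a0 ab bs; have /andP[h1 h2] := inc a b a0 ab.
  rewrite ger0_norm; last first.
    by apply: le_trans h1; rewrite mulr_ge0 ?subr_ge0 ?phi_ge0.
  apply: (le_trans h2); rewrite ler_wpM2l ?subr_ge0// /L.
  by rewrite (le_trans (nd _ _ (le_trans a0 ab) bs))// lerDl.
have sq (r : R) : `|r| <= `|s| + 1 -> r ^+ 2 <= (`|s| + 1) ^+ 2.
  by move=> rs; rewrite -(real_normK (num_real r)) lerXn2r ?nnegrE// addr_ge0.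
have sqc : (fun r : R => r ^+ 2) r @[r --> s] --> s ^+ 2.
  exact: exprn_continuous.
have e' : 0 < e / L by rewrite divr_gt0.
near=> r.
have rs : `|r| <= `|s| + 1.
  have : `|s - r| <= 1 by near: r; apply: cvgr_dist_le.
  move=> sr; rewrite -[r](subKr s) (le_trans (ler_normB _ _))// lerD2l//.
have d : `|s ^+ 2 - r ^+ 2| <= e / L.
  by near: r; move/cvgrPdist_le : sqc; exact.
have sq0 (x : R) : 0 <= x ^+ 2 by exact: sqr_ge0.
have -> : e = e / L * L by rewrite divfK ?gt_eqF.
have [sr|/ltW rs'] := leP (r ^+ 2) (s ^+ 2).
  apply: (le_trans (lip _ _ (sq0 _) sr _)).
    by apply: sq; rewrite lerDl.
  by rewrite ler_pM2r// (le_trans (ler_norm _)).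
rewrite distrC; apply: (le_trans (lip _ _ (sq0 _) rs' (sq _ rs))).
by rewrite ler_pM2r// (le_trans (ler_norm _))// distrC.
Unshelve. all: by end_near. Qed.

(** The gauge s + Phi (s^2) dominates every dilation of Phi, with a constant
    that depends on the dilation only: for s > 1 / k monotonicity suffices, and
    for s <= 1 / k convexity produces the factor s that makes the bound vanish
    with s. *)
Lemma young_dominated (R : realType) (Phi : R -> R) : young Phi ->
  forall k s, 0 < k <= 1 -> 0 <= s ->
    k * Phi (k^-1 * s) <= (1 + Phi (k ^- 2)) * (s + Phi (s ^+ 2)).
Proof.
move=> hPhi k s /andP[k0 k1] s0.
have Pge0 := young_ge0 hPhi.
have K : 0 <= k ^- 2 by rewrite invr_ge0 exprn_ge0// ltW.
have Q0 := Pge0 _ K.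
have S0 : 0 <= Phi (s ^+ 2) by rewrite Pge0// sqr_ge0.
have [sk|/ltW ks] := leP s k^-1.
  have sk1 : 0 <= s * k <= 1.
    by rewrite mulr_ge0 ?(ltW k0)//= -ler_pdivlMr// mul1r.
  have -> : k^-1 * s = (s * k) * k ^- 2.
    by field; rewrite gt_eqF.
  have h := young_scale_le hPhi sk1 K.
  have : k * Phi (s * k * k ^- 2) <= s * Phi (k ^- 2).
    apply: (le_trans (ler_wpM2l (ltW k0) h)).
    have kk1 : k * k <= 1 by nra.
    have sQ : 0 <= s * Phi (k ^- 2) by rewrite mulr_ge0.
    by nra.
  by nra.
have h : Phi (k^-1 * s) <= Phi (s ^+ 2).
  by apply: (le_young hPhi); rewrite ?mulr_ge0 ?invr_ge0 ?(ltW k0)//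
    expr2 ler_wpM2r.
have h0 : 0 <= Phi (k^-1 * s) by rewrite Pge0// mulr_ge0 ?invr_ge0 ?(ltW k0).
by nra.
Qed.

Lemma young_classK (R : realType) (Phi : R -> R) : young Phi ->
  classK (fun s => s + Phi (s ^+ 2)).
Proof.
move=> hPhi; split.
- apply: continuous_subspaceT => a.
  by apply: cvgD; [exact: cvg_id|exact: continuous_young_sqr].
- move=> x y x0 xy; apply: ltr_leD => //; apply: (le_young hPhi).
    exact: sqr_ge0.
  by rewrite lerXn2r ?nnegrE ?(ltW xy)// (le_trans x0)// ltW.
- by rewrite expr2 mul0r (young0 hPhi) addr0.
Qed.

(** * Functions of class K_infinity as lower envelopes *)

(** The infimum over 0 < k <= 1 of the affine functions k + D k * a is
    concave in a, hence continuous for a > 0.  Concavity enters through the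
    estimate f b <= (b / a) f a for 0 < a <= b, which holds for each of the
    affine functions.  The value k at a = 0 being arbitrarily small, f is
    continuous at 0 as well.  The summand a makes the sum strictly increasing
    and unbounded. *)
Lemma classKinfty_envelope (R : realType) (D : R -> R) :
  (forall k, 0 < k -> 0 <= D k) ->
  exists2 theta : R -> R, classKinfty theta &
    forall a x, 0 <= a -> (forall k, 0 < k <= 1 -> x <= k + D k * a) ->
      x <= theta a.
Proof.
move=> D0.
(* The absolute value extends f to an even function on the whole line, so that
   continuity needs no restriction to a half-line. *)
pose S (a : R) := [set k + D k * `|a| | k in [set k : R | 0 < k <= 1]].
pose f (a : R) : R := inf (S a).
have S0 a : S a !=set0.
  by exists (1 + D 1 * `|a|); exists 1 => //=; rewrite ltr01 lexx.
have Slb a : lbound (S a) 0.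
  by move=> _ [k /= /andP[k0 _] <-]; rewrite addr_ge0 ?mulr_ge0 ?D0 ?(ltW k0).
have f0 a : 0 <= f a by apply: lb_le_inf.
have fle a k : 0 < k <= 1 -> f a <= k + D k * `|a|.
  by move=> k01; apply: ge_inf; [exists 0; exact: Slb|exists k].
have fnd a b : `|a| <= `|b| -> f a <= f b.
  move=> ab; apply: lb_le_inf => // _ [k /= k01 <-].
  apply: (le_trans (fle a k k01)); rewrite lerD2l ler_wpM2l// D0//.
  by case/andP: k01.
have f00 : f 0 = 0.
  apply/eqP; rewrite eq_le f0 andbT; apply/ler_addgt0Pr => e e0.
  have k01 : 0 < Num.min e 1 <= 1 by rewrite lt_min e0 ltr01 ge_min lexx orbT.
  apply: (le_trans (fle 0 _ k01)).
  by rewrite normr0 mulr0 addr0 add0r ge_min lexx.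
have fscale a b : a != 0 -> `|a| <= `|b| -> f b <= `|b| / `|a| * f a.
  move=> a0 ab; have an0 : 0 < `|a| by rewrite normr_gt0.
  have q1 : 1 <= `|b| / `|a| by rewrite ler_pdivlMr// mul1r.
  rewrite -ler_pdivrMl ?(lt_le_trans ltr01)//.
  apply: lb_le_inf => // _ [k /= k01 <-].
  rewrite ler_pdivrMl ?(lt_le_trans ltr01)//.
  apply: (le_trans (fle b k k01)); rewrite mulrDr lerD//.
    by rewrite ler_peMl//; case/andP: k01 => /ltW.
  by rewrite mulrCA divfK// gt_eqF.
have fc : continuous f.
  move=> a; have [->|a0] := eqVneq a 0.
    apply/cvgrPdist_le => e e0; rewrite f00.
    pose k := Num.min (e / 2) 1.
    have k01 : 0 < k <= 1 by rewrite lt_min divr_gt0// ltr01 ge_min lexx orbT.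
    have k0 : 0 < k by case/andP: k01.
    have D10 : 0 < D k + 1 by rewrite ltr_wpDl// D0.
    have d0 : 0 < e / 2 / (D k + 1) by rewrite !divr_gt0.
    near=> b.
    have bd : `|b| <= e / 2 / (D k + 1).
      rewrite -normrN -sub0r; near: b.
      exact: (@cvgr_dist_le _ _ _ _ _ id (0 : R)).
    rewrite sub0r normrN ger0_norm//; apply: (le_trans (fle b k k01)).
    rewrite (splitr e) lerD ?ge_min ?lexx//.
    rewrite ler_pdivlMr// in bd; apply: le_trans bd.
    by rewrite mulrC ler_wpM2l// lerDl.
  have an0 : 0 < `|a| by rewrite normr_gt0.
  pose q (b : R) := `|b| / `|a|.
  have qc : q b @[b --> a] --> (1 : R).
    rewrite -[X in _ --> X](@divff _ `|a|) ?gt_eqF//.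
    by apply: cvgM; [apply: cvg_norm; exact: cvg_id|exact: cvg_cst].
  have d1 : `|q b - 1| @[b --> a] --> (0 : R).
    have := cvg_norm (cvgB qc (cvg_cst (1 : R))).
    by rewrite subrr normr0; apply.
  have dc : `|q b - 1| * f a @[b --> a] --> (0 : R).
    by have := cvgM d1 (cvg_cst (f a)); rewrite mul0r; apply.
  apply: (@squeeze_cvgr _ _ _ _ (fun b => f a - `|q b - 1| * f a)
    (fun b => f a + `|q b - 1| * f a)).
  - near=> b.
    have b0 : b != 0.
      by near: b; apply: (cvgr_neq0 a) => //; exact: cvg_id.
    have bn0 : 0 < `|b| by rewrite normr_gt0.
    have [ab|/ltW ba] := leP `|a| `|b|.
      have q1 : 1 <= q b by rewrite ler_pdivlMr// mul1r.
      have := fnd _ _ ab; have := fscale _ _ a0 ab; have := f0 a.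
      rewrite -/(q b) ger0_norm ?subr_ge0// => fa h1 h2.
      by apply/andP; split; nra.
    have q1 : q b <= 1 by rewrite ler_pdivrMr// mul1r.
    have h1 : q b * f a <= f b.
      have q0 : 0 <= q b by rewrite divr_ge0.
      apply: (le_trans (ler_wpM2l q0 (fscale _ _ b0 ba))).
      by rewrite mulrA /q mulrA divfK ?gt_eqF// divff ?gt_eqF// mul1r.
    have := fnd _ _ ba; have := f0 a.
    rewrite ler0_norm ?subr_le0// => fa h2.
    by apply/andP; split; nra.
  - by rewrite -[X in _ --> X]subr0; apply: (cvgB _ dc); exact: cvg_cst.
  - by rewrite -[X in _ --> X]addr0; apply: (cvgD _ dc); exact: cvg_cst.
exists (fun a => a + f a).
  split; first split.
  - apply: continuous_subspaceT => a.
    by apply: cvgD; [exact: cvg_id|exact: fc].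
  - move=> x y x0 xy; apply: ltr_leD => //; apply: fnd.
    by rewrite !ger0_norm ?(ltW (le_lt_trans x0 xy))// ltW.
  - by rewrite f00 addr0.
  - apply: (@ger_cvgy _ _ _ _ id) => //.
    by near=> x; rewrite lerDl.
move=> a x a0 h; apply: (@le_trans _ _ (f a)); last by rewrite lerDr.
by apply: lb_le_inf => // _ [k /= k01 <-]; rewrite ger0_norm//; exact: h.
Unshelve. all: by end_near. Qed.

(** * Homogeneity of the Bochner integral *)

Section Bochner.
Context (R : realType).
Local Notation mu := (@lebesgue_measure R).

(** Two simple functions are handled jointly throughout: one approximates
    f and the other c f, and only their values at the same point compare. *)
Lemma simple_on_measurable2 (V W : completeNormedModType R) (D : set R)
    (s : R -> V) (s' : R -> W) (P : V -> W -> Prop) :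
  simple_on D s -> simple_on D s' ->
  measurable (D `&` [set x | P (s x) (s' x)] : set (measurableTypeR R)).
Proof.
move=> [fs ms] [fs' ms'].
have -> : D `&` [set x | P (s x) (s' x)] =
    \bigcup_(v in s @` D) \bigcup_(w in s' @` D `&` [set w | P v w])
      ((D `&` s @^-1` [set v]) `&` (D `&` s' @^-1` [set w])).
  apply/seteqP; split => [x [Dx Px]|x [v _ [w [_ Pvw]]]].
    exists (s x); first by exists x.
    exists (s' x); last by [].
    by split; [exists x|].
  by move=> [[Dx sx] [_ s'x]]; split => //=; rewrite sx s'x.
apply: fin_bigcup_measurable => // v _.
apply: fin_bigcup_measurable => [|w _].
  by apply: sub_finite_set fs' => w [].
by apply: measurableI; [case: (ms v)|case: (ms' w)].
Qed.

Lemma measurable_fun_simple2 (V W : completeNormedModType R) (D : set R)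
    (s : R -> V) (s' : R -> W) (h : V -> W -> R) :
  simple_on D s -> simple_on D s' ->
  measurable_fun (D : set (measurableTypeR R)) (fun x => h (s x) (s' x)).
Proof.
move=> ss ss' mD Y mY.
exact: (@simple_on_measurable2 _ _ D s s' (fun v w => Y (h v w))).
Qed.

Lemma fine_measure_partition (V : completeNormedModType R)
    (D E : set R) (s : R -> V) :
  (mu D < +oo)%E -> measurable (D : set (measurableTypeR R)) ->
  simple_on D s -> measurable (E : set (measurableTypeR R)) -> E `<=` D ->
  fine (mu E) = \sum_(v \in s @` D) fine (mu (E `&` s @^-1` [set v])).
Proof.
move=> Dfin mD [fs ms] mE ED.
have EE : E = \bigcup_(v in s @` D) (E `&` s @^-1` [set v]).
  apply/seteqP; split => [x Ex|x [v _ []]//].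
  by exists (s x) => //; exists x => //; exact: ED.
have mEv v : measurable (E `&` s @^-1` [set v] : set (measurableTypeR R)).
  rewrite -(setIidl ED) -setIA; apply: measurableI => //.
  by case: (ms v).
rewrite {1}EE measure_fin_bigcup//; last first.
  by move=> v w _ _ [x [[_ /= <-] [_ /= <-]]].
rewrite !fsbig_finite// sum_fine// => v _.
rewrite ge0_fin_numE//; apply: le_lt_trans Dfin.
by apply: le_measure; rewrite ?inE// => x [/ED].
Qed.

(** The integral of a simple function may be computed on the common refinement
    of its partition with that of another simple function. *)
Lemma simple_integral_pairl (V W : completeNormedModType R)
    (D : set R) (s : R -> V) (s' : R -> W) :
  (mu D < +oo)%E -> measurable (D : set (measurableTypeR R)) ->
  simple_on D s -> simple_on D s' ->
  simple_integral D s = \sum_(v \in s @` D) \sum_(w \in s' @` D)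
    fine (mu (D `&` s @^-1` [set v] `&` s' @^-1` [set w])) *: v.
Proof.
move=> Dfin mD ss ss'; apply: eq_fsbigr => v _.
rewrite (fine_measure_partition Dfin mD ss'); last first.
- by move=> x [].
- by case: ss => _ /(_ v)[].
by case: ss' => fs' _; rewrite !fsbig_finite// scaler_suml.
Qed.

Lemma le_simple_integral_sub (V : completeNormedModType R)
    (D : set R) (s s' : R -> V) (c : R) :
  (mu D < +oo)%E -> measurable (D : set (measurableTypeR R)) ->
  simple_on D s -> simple_on D s' ->
  (`|c *: simple_integral D s - simple_integral D s'|%:E <=
    \int[mu]_(x in D) `|c *: s x - s' x|%:E)%E.
Proof.
move=> Dfin mD ss ss'.
have [fs ms] := ss; have [fs' ms'] := ss'.
pose E v w := D `&` s @^-1` [set v] `&` s' @^-1` [set w].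
have mE v w : measurable (E v w : set (measurableTypeR R)).
  rewrite (_ : E v w = (D `&` s @^-1` [set v]) `&` (D `&` s' @^-1` [set w])).
    by apply: measurableI; [case: (ms v)|case: (ms' w)].
  by rewrite setIACA setIid /E setIA.
have Efin v w : mu (E v w) \is a fin_num.
  rewrite ge0_fin_numE//; apply: le_lt_trans Dfin.
  by apply: le_measure; rewrite ?inE// => x [[]].
rewrite (simple_integral_pairl Dfin mD ss ss').
rewrite (simple_integral_pairl Dfin mD ss' ss).
rewrite (exchange_fsbig _ _ fs' fs) !pair_fsbig//.
set Z := _ `*` _.
have fZ : finite_set Z by exact: finite_setX.
rewrite !fsbig_finite// scaler_sumr -sumrB.
set Zs := finmap.enum_fset _.
(* Summed over all cells, h is the function under the integral sign. *)
pose h (z : V * V) x := `|c *: z.1 - z.2| * \1_(E z.1 z.2) x.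
apply: (@le_trans _ _ (\int[mu]_(x in D) (\sum_(z <- Zs) (h z x)%:E))%E);
  last first.
  rewrite le_eqVlt; apply/orP; left; apply/eqP; apply: eq_integral => x.
  rewrite inE => Dx; rewrite sumEFin; congr EFin.
  rewrite (bigD1_seq (s x, s' x)) ?finmap.fset_uniq//=; last first.
    by rewrite in_fset_set// inE; split; exists x.
  rewrite big1 ?addr0 => [|[v w] /= vw].
    by rewrite /h /= indicE mem_set ?mulr1.
  rewrite /h indicE memNset ?mulr0// => -[[_ /= sv] /= s'w].
  by move/eqP: vw; apply; rewrite sv s'w.
rewrite ge0_integral_sum//; last 2 first.
- move=> z; apply/measurable_EFinP/measurable_realfun.measurable_funM.
    exact: measurable_cst.
  by apply: measurable_indic; exact: (mE z.1 z.2).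
- by move=> z x _; rewrite lee_fin mulr_ge0.
have hE z : (\int[mu]_(x in D) (h z x)%:E =
    (fine (mu (E z.1 z.2)) * `|c *: z.1 - z.2|)%:E)%E.
  rewrite /h; under eq_integral do rewrite EFinM.
  rewrite ge0_integralZl//; last first.
    by apply/measurable_EFinP; apply: measurable_indic; exact: (mE z.1 z.2).
  rewrite integral_indic//.
  rewrite setIidl; last by move=> x [[]].
  by rewrite mulrC EFinM fineK//; exact: (Efin z.1 z.2).
rewrite (eq_bigr (fun z => (fine (mu (E z.1 z.2)) * `|c *: z.1 - z.2|)%:E));
  last by move=> z _; exact: hE.
rewrite sumEFin lee_fin; apply: (le_trans (ler_norm_sum _ _ _)).
apply: ler_sum => -[v w] _ /=.
have -> : D `&` s' @^-1` [set w] `&` s @^-1` [set v] = E v w.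
  by rewrite /E setIAC.
rewrite -/(E v w) !scalerA mulrC -scalerA -scalerBr normrZ.
by rewrite ger0_norm// fine_ge0.
Qed.

(** Additivity of the integral needs a Borel measurable summand; this
    provides one for the distance to a simple function. *)
Lemma bochner_measurable_dist (V : completeNormedModType R) (D : set R)
    (f s : R -> V) :
  bochner_measurable D f -> simple_on D s ->
  exists g : R -> R,
    [/\ measurable_fun D g, forall x, 0 <= g x
      & {ae mu, forall x, D x -> g x = `|f x - s x|}].
Proof.
move=> [sg [ssg [N [mN muN sN]]]] ss.
exists (fun x => \1_(~` N) x * `|f x - s x|); split => [|x|].
- apply: (@measurable_fun_cvg _ _ _ D
    (fun n x => \1_(~` N) x * `|sg n x - s x|)) => [n|x Dx].
    apply: measurable_realfun.measurable_funM.
      by apply: measurable_indic; exact: measurableC.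
    exact: (measurable_fun_simple2 (fun v w => `|v - w|) (ssg n) ss).
  have [Nx|Nx] := pselect (N x).
    rewrite indicE memNset ?mul0r//.
    by under eq_fun do rewrite mul0r; exact: cvg_cst.
  rewrite indicE mem_set// mul1r.
  under eq_fun do rewrite mul1r.
  apply: cvg_norm; apply: cvgB; last exact: cvg_cst.
  by apply: contrapT => /= h; apply: Nx; apply: sN => /= /(_ Dx).
- by rewrite mulr_ge0.
- exists N; split => // x /=; apply: contra_notP => Nx _.
  by rewrite indicE mem_set// mul1r.
Qed.

(** For c = 1 this is the uniqueness of the integral, and for c = 0 it says
    that the integral of 0 is 0. *)
Lemma bochner_integral_scale (V : completeNormedModType R) (D : set R)
    (f : R -> V) (c : R) (y y' : V) :
  (mu D < +oo)%E -> measurable (D : set (measurableTypeR R)) ->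
  is_bochner_integral D f y -> is_bochner_integral D (fun x => c *: f x) y' ->
  y' = c *: y.
Proof.
move=> Dfin mD [mf [s [ss fs sy]]] [mcf [s' [ss' fs' s'y]]].
have aeF := ae_filter_ringOfSetsType mu.
pose err n := (`|c|%:E * \int[mu]_(x in D) `|f x - s n x|%:E +
  \int[mu]_(x in D) `|c *: f x - s' n x|%:E)%E.
have err0 : err n @[n --> \oo] --> 0%E.
  rewrite -[X in _ --> X](adde0 0%E); apply: cvgeD => //.
  by rewrite -[X in _ --> X](mule0 (`|c|)%:E); apply: cvgeZl.
have le_err n :
    (`|c *: simple_integral D (s n) - simple_integral D (s' n)|%:E <= err n)%E.
  apply: (le_trans (le_simple_integral_sub c Dfin mD (ss n) (ss' n))).
  have [g [mg g0 gE]] := bochner_measurable_dist mf (ss n).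
  have [g' [mg' g'0 g'E]] := bochner_measurable_dist mcf (ss' n).
  apply: (@le_trans _ _ (\int[mu]_(x in D) (`|c| * g x + g' x)%:E)%E).
    apply: ae_le_integral_ge0 => // [x _|]; first by rewrite addr_ge0 ?mulr_ge0.
    apply: (filterS2 _ _ gE g'E) => x gx g'x Dx; rewrite gx// g'x//.
    rewrite -normrZ scalerBr -[X in X - s' n x](subrK (c *: f x)) -addrA.
    by rewrite (le_trans (ler_normD _ _))// lerD2r distrC.
  under eq_integral do rewrite EFinD EFinM.
  rewrite ge0_integralD//; last 4 first.
  - by move=> x _; rewrite mule_ge0 ?lee_fin.
  - by apply: measurable_funeM; exact/measurable_EFinP.
  - by move=> x _; rewrite lee_fin.
  - exact/measurable_EFinP.
  rewrite ge0_integralZl//; last 2 first.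
  - exact/measurable_EFinP.
  - by move=> x _; rewrite lee_fin.
  apply: leeD; last first.
    apply: ae_le_integral_ge0 => //.
    by apply: filterS g'E => x h Dx; rewrite h.
  apply: lee_wpmul2l; first by rewrite lee_fin.
  apply: ae_le_integral_ge0 => //.
  by apply: filterS gE => x h Dx; rewrite h.
have lim0 : `|c *: simple_integral D (s n) - simple_integral D (s' n)|
    @[n --> \oo] --> (0 : R).
  apply: (@fine_cvg _ _ _ _
    (fun n => `|c *: simple_integral D (s n) - simple_integral D (s' n)|%:E)).
  apply: (squeeze_cvge _ (cvg_cst _) err0).
  by near=> n; rewrite le_err lee_fin normr_ge0.
have lim1 : `|c *: simple_integral D (s n) - simple_integral D (s' n)|
    @[n --> \oo] --> `|c *: y - y'|.
  by apply: cvg_norm; apply: cvgB => //; apply: cvgZ => //; exact: cvg_cst.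
have /eqP : `|c *: y - y'| = 0.
  by apply: (cvg_unique _ lim1 lim0); exact: norm_hausdorff.
by rewrite normr_eq0 subr_eq0 => /eqP.
Unshelve. all: by end_near. Qed.

End Bochner.

(** * Essentially bounded inputs and the Luxemburg norm *)

Section Inputs.
Context (R : realType) (U : completeNormedModType R) (Phi : R -> R).
Hypothesis hPhi : young Phi.
Local Notation mu := (@lebesgue_measure R).
Implicit Types (u : R -> U) (t : R).

Let aeF := ae_filter_ringOfSetsType mu.

Lemma orlicz_integrand_ge0 u (D : set R) k : 0 < k ->
  forall x, D x -> 0 <= Phi (k^-1 * `|u x|).
Proof.
by move=> k0 x _; rewrite (young_ge0 hPhi)// mulr_ge0// invr_ge0 ltW.
Qed.

Lemma Linfty_scale (D : set R) u c :
  (mu D < +oo)%E -> measurable (D : set (measurableTypeR R)) ->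
  Linfty D u -> Linfty D (fun x => c *: u x).
Proof.
move=> Dfin mD [[s [ss su]] [M Mu]]; split; last first.
  exists (`|c| * M); apply: (@filterS _ _ aeF) Mu => x h Dx.
  by rewrite normrZ ler_wpM2l// h.
exists (fun n x => c *: s n x); split => [n|]; last first.
  apply: (@filterS _ _ aeF) su => x h Dx.
  by apply: cvgZ; [exact: cvg_cst|exact: h].
have mP v := simple_on_measurable2 (fun a _ : U => c *: a = v) (ss n) (ss n).
split; last first.
  move=> v; split; first exact: mP.
  move=> _; apply: le_lt_trans Dfin; apply: le_measure; rewrite ?inE//.
  exact: mP.
rewrite (_ : _ @` D = (fun v : U => c *: v) @` (s n @` D));
  last by rewrite image_comp.
by apply: finite_image; case: (ss n).
Qed.

Lemma luxemburg_norm_ge0 (D : set R) u : 0 <= luxemburg_norm Phi D u.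
Proof.
rewrite /luxemburg_norm; set S := [set _ | _].
have [->|S0] := eqVneq S set0; first by rewrite inf0.
by apply: lb_le_inf; [exact/set0P|move=> k [/ltW]].
Qed.

Lemma luxemburg_norm_le (D : set R) u k : 0 < k ->
  (orlicz_modular Phi D u k <= 1)%E -> luxemburg_norm Phi D u <= k.
Proof.
move=> k0 uk; apply: ge_inf; last by [].
by exists 0 => l [/ltW].
Qed.

Lemma luxemburg_norm0 (D : set R) u : (forall x, u x = 0) ->
  luxemburg_norm Phi D u = 0.
Proof.
move=> u0; apply/eqP; rewrite eq_le luxemburg_norm_ge0 andbT.
apply/ler_addgt0Pr => e e0; rewrite add0r; apply: luxemburg_norm_le => //.
rewrite /orlicz_modular integral0_eq// => x _.
by rewrite u0 normr0 mulr0 (young0 hPhi).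
Qed.

Lemma Linfty_integral_lty t u (h : R -> R) :
  (forall s, 0 <= s -> 0 <= h s) ->
  (forall a b, 0 <= a -> a <= b -> h a <= h b) ->
  Linfty `[0, t]%classic u ->
  (\int[mu]_(x in `[0%R, t]) (h `|u x|)%:E < +oo)%E.
Proof.
move=> h0 hnd [_ [M Mu]].
have H : 0 < h `|M| + 1 by rewrite ltr_wpDl// h0.
apply: (@le_lt_trans _ _ ((h `|M| + 1)%:E * \int[mu]_(x in `[0%R, t]) 1%:E)%E).
  apply: ae_le_integral_scale => //; first by move=> x _; exact: h0.
  apply: (@filterS _ _ aeF) Mu => x hx /hx uM; rewrite mulr1.
  apply: (@le_trans _ _ (h `|M|)); last by rewrite lerDl.
  by apply: hnd => //; exact: le_trans (ler_norm _).
rewrite integral_cst// mul1e lte_mul_pinfty ?lee_fin ?(ltW H)//.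
exact: lebesgue_bounded_itv_lty.
Qed.

Lemma modular_lty t u k : 0 < k -> Linfty `[0, t]%classic u ->
  (orlicz_modular Phi `[0%R, t]%classic u k < +oo)%E.
Proof.
move=> k0; apply: (@Linfty_integral_lty t u (fun s => Phi (k^-1 * s))).
  by move=> s s0; rewrite (young_ge0 hPhi)// mulr_ge0// invr_ge0 ltW.
move=> a b a0 ab.
by apply: (le_young hPhi); rewrite ?mulr_ge0 ?ler_wpM2l ?invr_ge0 ?(ltW k0).
Qed.

(** A bounded function on a bounded interval has finite modular at every scale,
    and it is its own bounded approximation. *)
Lemma Linfty_EPhi t u : Linfty `[0, t]%classic u -> EPhi Phi `[0, t]%classic u.
Proof.
move=> uL; split; first split; first by case: uL.
  by exists 1 => //; exact: modular_lty.
move=> e e0; exists u => //.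
by rewrite luxemburg_norm0// => x /=; rewrite subrr.
Qed.

(** Amemiya's bound on the Luxemburg norm, as membership in the unit ball.  If J
    is the modular of u at scale k, then 1 + J >= 1, so by convexity a further
    division by 1 + J brings the modular down to J / (1 + J) <= 1. *)
Lemma luxemburg_norm_amemiya t u k : 0 < k -> Linfty `[0, t]%classic u ->
  luxemburg_norm Phi `[0, t]%classic (fun x =>
    (k * (1 + fine (orlicz_modular Phi `[0, t]%classic u k)))^-1 *: u x) <= 1.
Proof.
move=> k0 uL; set J := orlicz_modular _ _ _ _; pose m := 1 + fine J.
rewrite -/m.
have J0 : (0 <= J)%E.
  by apply: integral_ge0 => x Dx; rewrite lee_fin;
    rewrite (@orlicz_integrand_ge0 _ `[0, t]%classic).
have m1 : 1 <= m by rewrite lerDl fine_ge0.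
have m0 : 0 < m := lt_le_trans ltr01 m1.
apply: luxemburg_norm_le => //.
rewrite /orlicz_modular.
apply: (@le_trans _ _ ((m^-1)%:E * J)%E).
  apply: ae_le_integral_scale => //.
  - by rewrite invr_gt0.
  - exact: orlicz_integrand_ge0.
  - exact: orlicz_integrand_ge0.
  - apply: aeW => x _; rewrite invr1 mul1r normrZ.
    rewrite ger0_norm ?invr_ge0 ?mulr_ge0 ?(ltW k0) ?(ltW m0)//.
    rewrite invfM [k^-1 * _]mulrC -mulrA.
    apply: (young_scale_le hPhi).
      by rewrite invr_ge0 (ltW m0) invf_le1.
    by rewrite mulr_ge0// invr_ge0 ltW.
have /fineK <- : J \is a fin_num by rewrite ge0_fin_numE// modular_lty.
by rewrite -EFinM lee_fin mulrC ler_pdivrMr// mul1r lerDr.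
Qed.

Lemma scaled_modular_le_integral t u k :
  0 < k <= 1 -> Linfty `[0, t]%classic u ->
  k * fine (orlicz_modular Phi `[0, t]%classic u k) <=
  (1 + Phi (k ^- 2)) *
    (\int[mu]_(s in `[0%R, t]) (`|u s| + Phi (`|u s| ^+ 2)))%R.
Proof.
move=> /[dup] k01 /andP[k0 _] uL.
have c0 : 0 < 1 + Phi (k ^- 2).
  by rewrite ltr_pwDl// (young_ge0 hPhi)// invr_ge0 exprn_ge0// ltW.
have [/= _ knd _] := young_classK hPhi.
have h0 s : 0 <= s -> 0 <= s + Phi (s ^+ 2).
  by move=> s0; rewrite addr_ge0// (young_ge0 hPhi)// sqr_ge0.
have hnd a b : 0 <= a -> a <= b -> a + Phi (a ^+ 2) <= b + Phi (b ^+ 2).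
  by move=> a0; rewrite le_eqVlt => /predU1P[->//|ab]; rewrite ltW// knd.
have fI := Linfty_integral_lty h0 hnd uL.
have I0 : (0 <= \int[mu]_(s in `[0%R, t]) (`|u s| + Phi (`|u s| ^+ 2))%:E)%E.
  by apply: integral_ge0 => x _; rewrite lee_fin h0.
have : (orlicz_modular Phi `[0%R, t]%classic u k <=
    ((1 + Phi (k ^- 2)) / k)%:E *
    \int[mu]_(s in `[0%R, t]) (`|u s| + Phi (`|u s| ^+ 2))%:E)%E.
  apply: ae_le_integral_scale; [exact: divr_gt0|exact: orlicz_integrand_ge0| |].
    by move=> x _; exact: h0.
  apply: aeW => x _; rewrite mulrAC ler_pdivlMr// mulrC.
  exact: young_dominated.
rewrite /Rintegral.
set J := orlicz_modular _ _ _ _; set I := integral _ _ _ in fI I0 *.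
have /fineK {1}<- : J \is a fin_num.
  rewrite ge0_fin_numE ?modular_lty//.
  by apply: integral_ge0 => x Dx; rewrite lee_fin;
    rewrite (@orlicz_integrand_ge0 _ `[0, t]%classic).
have /fineK {1}<- : I \is a fin_num by rewrite ge0_fin_numE.
by rewrite -EFinM lee_fin mulrAC ler_pdivlMr// mulrC.
Qed.

End Inputs.

(** * Strong ISS and the forced response *)

Lemma resolvent_inj (R : realType) (X : completeNormedModType R)
    (domA : set X) (A : X -> X) (lambda : R) (Rl : {linear X -> X}) :
  is_resolvent domA A lambda Rl -> forall x, Rl x = 0 -> x = 0.
Proof.
move=> [_ RlK _] x Rx0; have [_ <-] := RlK x; have [_ R0] := RlK 0.
by move: R0; rewrite linear0 Rx0.
Qed.

Lemma extrapolation_inj (R : realType) (X Y : completeNormedModType R)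
    (domA : set X) (A : X -> X) (lambda : R) (Rl : {linear X -> X})
    (i : {linear X -> Y}) :
  is_resolvent domA A lambda Rl -> is_extrapolation_space Rl i -> injective i.
Proof.
move=> hRl [iE _] x y ixy; apply/eqP; rewrite -subr_eq0; apply/eqP.
apply: (resolvent_inj hRl); apply/eqP; rewrite -normr_eq0 -iE.
by rewrite linearB ixy subrr normr0.
Qed.

Section ForcedResponse.
Context (R : realType) (X U Y : completeNormedModType R).
Context (i : {linear X -> Y}) (T : R -> {linear X -> X})
  (Tm : R -> {linear Y -> Y}) (B : {linear U -> Y}).
Hypothesis iinj : injective i.

(** The forced response z - T t x1 does not depend on the initial state and is
    homogeneous in the input; c = 0 gives the free motion. *)
Lemma is_state_scale t x0 x1 u c x z :
  is_state i T Tm B t x0 u x ->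
  is_state i T Tm B t x1 (fun s => c *: u s) z ->
  z - T t x1 = c *: (x - T t x0).
Proof.
move=> [y by_ ixE] [y' by' izE]; apply: iinj.
rewrite linearZ !linearB ixE izE ![_ + _ - _]addrAC !subrr !add0r.
apply: (@bochner_integral_scale R Y `[0, t]%classic
  (fun s => Tm (t - s) (B (u s)))) => //.
  exact: lebesgue_bounded_itv_lty.
have <- : (fun s => Tm (t - s) (B (c *: u s))) =
    (fun s => c *: Tm (t - s) (B (u s))) by apply/funext => s; rewrite !linearZ.
by [].
Qed.

Variables (Phi : R -> R) (mu : R -> R) (beta : X -> R -> R).
Hypothesis hPhi : young Phi.
Hypothesis hmu : classK mu.
Hypothesis beta0 : forall x t, 0 <= t -> 0 <= beta x t.
Hypothesis hbeta : forall x, x != 0 -> classL (beta x).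
Hypothesis iss : forall (t : R) (x0 : X) (u : R -> U), 0 <= t ->
  EPhi Phi `[0, t]%classic u ->
  exists2 x, is_state i T Tm B t x0 u x
    & `|x| <= beta x0 t + mu (luxemburg_norm Phi `[0, t]%classic u).

Let Linfty_segment_scale t (u : R -> U) c : Linfty `[0, t]%classic u ->
  Linfty `[0, t]%classic (fun s => c *: u s).
Proof. by apply: Linfty_scale => //; exact: lebesgue_bounded_itv_lty. Qed.

Lemma semigroup_le_beta t x0 (u : R -> U) :
  0 <= t -> Linfty `[0, t]%classic u ->
  `|T t x0| <= beta x0 t.
Proof.
move=> t0 uL.
have [x sx _] := iss x0 t0 (Linfty_EPhi hPhi uL).
have [z sz] := iss x0 t0 (Linfty_EPhi hPhi (Linfty_segment_scale 0 uL)).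
have /eqP := is_state_scale sx sz; rewrite scale0r subr_eq0 => /eqP ->.
have [_ _ mu0] := hmu.
by rewrite luxemburg_norm0 ?mu0 ?addr0// => s; rewrite scale0r.
Qed.

(** The value of beta at the initial state 0 need not decay or even be bounded
    in t, so the estimate is taken at a nonzero state e, where
    beta e t <= beta e 0, and the free motion T t e is subtracted. *)
Lemma forced_response_bound : exists2 C : R, 1 <= C &
  forall t x0 x (u : R -> U) c, 0 <= t -> Linfty `[0, t]%classic u -> 0 < c ->
    luxemburg_norm Phi `[0, t]%classic (fun s => c^-1 *: u s) <= 1 ->
    is_state i T Tm B t x0 u x -> `|x - T t x0| <= C * c.
Proof.
have [_ muinc mu0] := hmu.
have mund a b : 0 <= a -> a <= b -> mu a <= mu b.
  by move=> a0; rewrite le_eqVlt => /predU1P[->//|/(muinc _ _ a0)/ltW].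
have [[e e0]|noe] := pselect (exists e : X, e != 0); last first.
  (* X is trivial. *)
  exists 1 => // t x0 x u c _ _ c0 _ _.
  have [->|xx] := eqVneq (x - T t x0) 0; first by rewrite normr0 mul1r ltW.
  by exfalso; apply: noe; exists (x - T t x0).
have [_ _ bdec _] := hbeta e0.
have mu1 : 0 <= mu 1 by rewrite -mu0 mund.
have be0 : 0 <= beta e 0 by exact: beta0.
exists (1 + 2 * beta e 0 + mu 1).
  by rewrite -addrA lerDl addr_ge0// mulr_ge0.
move=> t x0 x u c t0 uL c0 lux1 sx.
have bt : beta e t <= beta e 0.
  by move: t0; rewrite le_eqVlt => /predU1P[<-//|t0]; rewrite ltW// bdec.
have [z sz zle] := iss e t0 (Linfty_EPhi hPhi (Linfty_segment_scale c^-1 uL)).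
have zE := is_state_scale sx sz.
have -> : x - T t x0 = c *: (z - T t e).
  by rewrite zE scalerA mulfV ?gt_eqF// scale1r.
rewrite normrZ gtr0_norm// mulrC ler_pM2r//.
apply: (le_trans (ler_normB _ _)).
have Te := semigroup_le_beta e t0 uL.
have := mund _ _ (luxemburg_norm_ge0 Phi _ _) lux1.
by lra.
Qed.

End ForcedResponse.

Theorem theorem3p3 (R : realType) (X U Xm1 : completeNormedModType R)
  (T : R -> {linear X -> X}) (domA : set X) (A : X -> X)
  (lambda : R) (Rl : {linear X -> X})
  (i : {linear X -> Xm1}) (Tm1 : R -> {linear Xm1 -> Xm1})
  (B : {linear U -> Xm1})
  (hT : c0_semigroup T) (hA : generator T domA A)
  (hRl : is_resolvent domA A lambda Rl)
  (hXm1 : is_extrapolation_space Rl i)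
  (hTm1 : extends_semigroup i T Tm1)
  (hB : continuous B) :
  (exists2 Phi : R -> R, young Phi
     & sISS i T Tm1 B (EPhi Phi) (luxemburg_norm Phi)) ->
  siISS i T Tm1 B (@Linfty R U).
Proof.
move=> [Phi hPhi [mu [beta [hmu beta0 hbeta iss]]]].
have iinj := extrapolation_inj hRl hXm1.
have [C C1 hC] := forced_response_bound iinj hPhi hmu beta0 hbeta iss.
have C0 : 0 < C := lt_le_trans ltr01 C1.
(* The scale k / C instead of k turns the term C k of the estimate into k. *)
pose D k := C * (1 + Phi ((k / C) ^- 2)).
have D0 k : 0 < k -> 0 <= D k.
  move=> k0; rewrite mulr_ge0 ?(ltW C0)// addr_ge0// (young_ge0 hPhi)//.
  by rewrite invr_ge0 exprn_ge0// divr_ge0 ?ltW.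
have [theta htheta thetaP] := classKinfty_envelope D0.
exists theta, (fun s => s + Phi (s ^+ 2)), beta; split => //.
  exact: young_classK.
move=> t x0 u t0 uL.
have [x sx _] := iss t x0 u t0 (Linfty_EPhi hPhi uL).
exists x => //.
rewrite -[x](subrK (T t x0)) addrC (le_trans (ler_normD _ _))//.
rewrite lerD//; first exact: (semigroup_le_beta iinj hPhi hmu iss x0 t0 uL).
apply: thetaP.
  apply: Rintegral_ge0 => s _.
  by rewrite addr_ge0// (young_ge0 hPhi)// sqr_ge0.
move=> k /andP[k0 k1].
have kC0 : 0 < k / C by rewrite divr_gt0.
have kC1 : 0 < k / C <= 1.
  by rewrite kC0 ler_pdivrMr// mul1r (le_trans k1).
set J := fine (orlicz_modular Phi `[0, t]%classic u (k / C)).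
have J0 : 0 <= J.
  apply/fine_ge0/integral_ge0 => s Ds.
  by rewrite lee_fin (orlicz_integrand_ge0 hPhi _ kC0 Ds).
have kJ0 : 0 < k / C * (1 + J) by rewrite mulr_gt0// ltr_pwDl.
have lux1 := luxemburg_norm_amemiya hPhi kC0 uL.
apply: (le_trans (hC _ _ _ _ _ t0 uL kJ0 lux1 sx)).
have := ler_wpM2l (ltW C0) (scaled_modular_le_integral hPhi kC1 uL).
rewrite -/J mulrA -/(D k) => h.
rewrite mulrDr mulr1 mulrDr [C * (k / C)]mulrC divfK ?gt_eqF// lerD2l.
by rewrite /D -!mulrA in h *.
Qed.
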